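(* Let $\bm{R}\in\mathbb{C}^{M\times M}$ be Hermitian positive definite, let $T$ be a positive integer, and let $\bm{u}_{\max}$ be a unit-norm eigenvector of $\bm{R}$ associated with its largest eigenvalue. In the low-SNR regime, a sensing-optimal transmit covariance is the rank-one matrix $$\bm{\Sigma}^\star=MT\,\bm{u}_{\max}\bm{u}_{\max}^{H};$$ that is, $\bm{\Sigma}^\star$ attains the maximum in $$\max_{\bm{\Sigma}\succeq\bm{0}}\ \mathrm{tr}(\bm{R}^2\bm{\Sigma})\quad\text{subject to}\quad\mathrm{tr}(\bm{\Sigma})=MT.$$
   Context: $\bm{R}=\mathbb{E}[\mathsf{H}_{\rm s}^{H}\mathsf{H}_{\rm s}]$ is the correlation matrix of the sensing channel, and the sensing metric of a random transmit signal $\mathsf{X}\in\mathbb{C}^{M\times T}$ with $\mathbb{E}[\mathrm{tr}(\mathsf{X}\mathsf{X}^{H})]=MT$ is $J_{\rm EMMSE}=\mathbb{E}[\mathrm{tr}((\bm{R}^{-1}+\kappa\mathsf{X}\mathsf{X}^{H})^{-1})]$, where $\kappa>0$ is proportional to the sensing SNR. As $\kappa\to0$, $J_{\rm EMMSE}=\mathrm{tr}(\bm{R})-\kappa\,\mathrm{tr}(\bm{R}^2\bm{\Sigma})+o(\kappa)$ with $\bm{\Sigma}=\mathbb{E}[\mathsf{X}\mathsf{X}^{H}]$. ''Sensing-optimal in the low-SNR regime'' means that $\bm{\Sigma}$ minimizes this first-order expansion, i.e. solves the maximization problem displayed in the claim over Hermitian positive semidefinite $\bm{\Sigma}\in\mathbb{C}^{M\times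 M}$. *)

(* Defs.v *)
From mathcomp Require Export all_boot all_order all_algebra.
From mathcomp Require Export reals complex.

Set Implicit Arguments.
Unset Strict Implicit.
Unset Printing Implicit Defensive.

Import Order.TTheory GRing.Theory Num.Theory.

Local Open Scope ring_scope.
Local Open Scope sesquilinear_scope.

(* The order of a numClosedFieldType is partial: x <= y (resp. x < y) says that
   y - x is real and nonnegative (resp. positive).  All inequalities below are
   meant in this sense; between real numbers it is the usual order. *)

Definition vnorm (C : numClosedFieldType) (n : nat) (u : 'cV[C]_n) : C :=
  sqrtC (\sum_i `|u i 0| ^+ 2).

Definition quad_form (C : numClosedFieldType) (n : nat)
    (A : 'M[C]_n) (x : 'cV[C]_n) : C :=
  (x^t* *m A *m x) 0 0.

Definition posdefmx (C : numClosedFieldType) (n : nat) (A : 'M[C]_n) : Prop :=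
  A \is hermsymmx /\ forall x : 'cV[C]_n, x != 0 -> 0 < quad_form A x.

Definition possemidefmx (C : numClosedFieldType) (n : nat) (A : 'M[C]_n)
    : Prop :=
  A \is hermsymmx /\ forall x : 'cV[C]_n, 0 <= quad_form A x.

(* [eigenvalue] is stated with row eigenvectors; a square matrix has the same
   eigenvalues for row and for column eigenvectors. *)
Definition largest_eigenvalue (C : numClosedFieldType) (n : nat)
    (A : 'M[C]_n) (lam : C) : Prop :=
  eigenvalue A lam /\ forall mu : C, eigenvalue A mu -> mu <= lam.

Definition feasible_covariance (C : numClosedFieldType) (M T : nat)
    (S : 'M[C]_M) : Prop :=
  possemidefmx S /\ \tr S = (M * T)%:R.

(* As kappa -> 0 the sensing metric
     E[tr((R^-1 + kappa X X^H)^-1)] = tr R - kappa tr(R^2 S) + o(kappa),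
   with S = E[X X^H], so that minimizing its first-order expansion amounts to
   maximizing tr(R^2 S). *)
Definition low_snr_sensing_optimal (C : numClosedFieldType) (M T : nat)
    (R S : 'M[C]_M) : Prop :=
  feasible_covariance T S /\
  forall S' : 'M[C]_M, feasible_covariance T S' ->
    \tr (R *m R *m S') <= \tr (R *m R *m S).

(* Main.v *)
Require Import Defs.
Import Order.TTheory GRing.Theory Num.Theory.
Local Open Scope ring_scope.
Local Open Scope sesquilinear_scope.
Local Open Scope complex_scope.

(** Diagonalize R = P^H D P with P unitary.  Positive definiteness and the
    maximality of lam give 0 < d_i <= lam for the diagonal entries of D, and
    the diagonal entries of P S P^H are nonnegative with sum tr S, hence
    tr(R^2 S) = sum_i d_i^2 (P S P^H)_ii <= lam^2 tr S.  The rank-one matrix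
    M T u u^H attains this bound. *)

Lemma adjmx_mul (C : numClosedFieldType) (m n p : nat)
    (A : 'M[C]_(m, n)) (B : 'M[C]_(n, p)) : (A *m B)^t* = B^t* *m A^t*.
Proof. by rewrite trmx_mul map_mxM. Qed.

Lemma vnorm_sqr (C : numClosedFieldType) (n : nat) (u : 'cV[C]_n) :
  u^t* *m u = (vnorm u ^+ 2)%:M.
Proof.
rewrite [LHS]mx11_scalar sqrtCK mxE; congr (_%:M).
by apply: eq_bigr => i _; rewrite !mxE mulrC normCK.
Qed.

(** The quadratic form at [x] is [c] times the squared modulus of [u^H x]. *)
Lemma possemidef_rank1 (C : numClosedFieldType) (n : nat) (c : C)
    (u : 'cV[C]_n) : 0 <= c -> possemidefmx (c *: (u *m u^t*)).
Proof.
move=> c0; split.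
  apply/is_hermitianmxP; rewrite expr0 scale1r linearZ /= map_mxZ adjmx_mul.
  (* Being nonnegative in the partial order forces [c] to be real, so conjugation fixes it. *)
  by rewrite trmxCK; congr (_ *: _); apply/esym/CrealP/ger0_real.
move=> x; rewrite /quad_form -scalemxAr -scalemxAl mxE mulr_ge0 //.
have -> : x^t* *m (u *m u^t*) *m x = (x^t* *m u) *m (x^t* *m u)^t*.
  by rewrite adjmx_mul trmxCK !mulmxA.
by rewrite mxE big_ord1 [_^t* _ _]mxE [_^T _ _]mxE mul_conjC_ge0.
Qed.

(** Transfers sign information on the form of [A] to the diagonal of a congruent matrix. *)
Lemma congruence_diag (C : numClosedFieldType) (m n : nat)
    (A : 'M[C]_n) (P : 'M[C]_(m, n)) (i : 'I_m) :
  (P *m A *m P^t*) i i = quad_form A ((row i P)^t*).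
Proof.
rewrite /quad_form trmxCK -row_mul !mxE.
by apply: eq_bigr => k _; rewrite !mxE.
Qed.

Lemma spectral_decomp (C : numClosedFieldType) (n : nat) (A : 'M[C]_n) :
  A \is hermsymmx ->
  A = (spectralmx A)^t* *m diag_mx (spectral_diag A) *m spectralmx A.
Proof.
move=> hermA; rewrite -invmx_unitary ?spectral_unitarymx //.
exact/orthomx_spectralP/hermitian_normalmx.
Qed.

Lemma mul_spectralmx (C : numClosedFieldType) (n : nat) (A : 'M[C]_n) :
  A \is hermsymmx ->
  spectralmx A *m A = diag_mx (spectral_diag A) *m spectralmx A.
Proof.
move=> /spectral_decomp eA; have /unitarymxP PP := spectral_unitarymx A.
by rewrite [X in _ *m X = _]eA !mulmxA PP mul1mx.
Qed.

Lemma row_spectralmx_neq0 (C : numClosedFieldType) (n : nat) (A : 'M[C]_n)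
    (i : 'I_n) : row i (spectralmx A) != 0.
Proof.
apply/eqP => Pi0; have /unitarymxP PP := spectral_unitarymx A.
(* A zero row [i] would make the entry [(i, i)] of [P P^H = 1] vanish. *)
have /matrixP/(_ 0 i)/eqP := row_mul i (spectralmx A) ((spectralmx A)^t*).
by rewrite PP Pi0 mul0mx !mxE eqxx oner_eq0.
Qed.

(** By [P A = D P], the rows of [P] are left eigenvectors. *)
Lemma spectral_diag_eigenvalue (C : numClosedFieldType) (n : nat)
    (A : 'M[C]_n) (i : 'I_n) :
  A \is hermsymmx -> eigenvalue A (spectral_diag A 0 i).
Proof.
move=> hermA; apply/eigenvalueP; exists (row i (spectralmx A)).
  by rewrite -row_mul mul_spectralmx // row_mul row_diag_mx -scalemxAl -rowE.
exact: row_spectralmx_neq0.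
Qed.

Lemma spectral_diag_gt0 (C : numClosedFieldType) (n : nat)
    (A : 'M[C]_n) (i : 'I_n) : posdefmx A -> 0 < spectral_diag A 0 i.
Proof.
move=> [hermA posA].
(* This is the entry [(i, i)] of [P A P^H = D]. *)
have -> : spectral_diag A 0 i = quad_form A ((row i (spectralmx A))^t*).
  by rewrite -congruence_diag mul_spectralmx // mulmxtVK
    ?spectral_unitarymx // mxE eqxx.
apply: posA; apply: contra_neq (row_spectralmx_neq0 _ _ A i) => P0.
by rewrite -[LHS]trmxCK P0 trmx0 map_mx0.
Qed.

Lemma mxtrace_sqr_mul_le (C : numClosedFieldType) (n : nat)
    (A S : 'M[C]_n) (lam : C) :
  posdefmx A -> largest_eigenvalue A lam -> possemidefmx S ->
  \tr (A *m A *m S) <= lam ^+ 2 * \tr S.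
Proof.
move=> posA [_ maxlam] [_ posS]; have hermA := posA.1.
set P := spectralmx A; set d := spectral_diag A.
have PP : P \is unitarymx := spectral_unitarymx A.
have trS : \tr S = \tr (P *m S *m P^t*).
  by rewrite mxtrace_mulC mulmxA -invmx_unitary // mulVmx ?mul1mx //
    unitarymx_unit.
have -> : \tr (A *m A *m S)
    = \tr (diag_mx d *m (diag_mx d *m (P *m S *m P^t*))).
  (* Only the first factor [A] is diagonalized; after a cyclic shift, [P A = D P] turns the second
     one into another [D]. *)
  rewrite {1}(spectral_decomp _ _ _ hermA) -!mulmxA mxtrace_mulC.
  by rewrite -/P (mulmxA P A) mul_spectralmx // !mulmxA.
rewrite trS /mxtrace mulr_sumr; apply: ler_sum => i _.
rewrite !mul_diag_mx 2!mxE mulrA -expr2 ler_wpM2r //.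
  by rewrite congruence_diag.
have di0 := spectral_diag_gt0 _ _ _ i posA.
have dil := maxlam _ (spectral_diag_eigenvalue _ _ _ i hermA).
(* Squaring is monotone on nonnegative elements; [lam] is one since it dominates [d_i > 0]. *)
by rewrite lerXn2r // nnegrE ?(le_trans (ltW di0) dil) // ltW.
Qed.

Theorem theorem2 (K : realType) (M T : nat) (R : 'M[K[i]]_M)
    (lam_max : K[i]) (u_max : 'cV[K[i]]_M) :
  posdefmx R ->
  (0 < T)%N ->
  largest_eigenvalue R lam_max ->
  R *m u_max = lam_max *: u_max ->
  vnorm u_max = 1 ->
  low_snr_sensing_optimal T R ((M * T)%:R *: (u_max *m u_max^t*)).
Proof.
move=> posR _ maxlam Ru u1.
have uu : \tr (u_max *m u_max^t*) = 1.
  by rewrite mxtrace_mulC vnorm_sqr u1 expr1n mxtrace1.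
split; first split.
- exact: possemidef_rank1.
- by rewrite mxtraceZ uu mulr1.
move=> S [posS trS].
rewrite (le_trans (mxtrace_sqr_mul_le _ _ _ _ _ posR maxlam posS)) //.
(* Applying the eigenvector equation twice gives [R^2 u u^H = lam^2 u u^H], so the objective equals
   the bound [lam^2 M T]. *)
rewrite trS -scalemxAr mxtraceZ -!mulmxA (mulmxA R u_max) Ru -scalemxAl.
by rewrite -scalemxAr mulmxA Ru -scalemxAl !mxtraceZ uu mulr1 mulrC expr2.
Qed.
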